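(* Let $\mathbf{x}(u,v)$ be a rational parametrization. If $\mathbf{x}(u,v)$ defines an affine rotation surface $S$ about an axis $\mathcal{A}$ with Plücker coordinates $(\beta,\alpha)$, where $\alpha=(\alpha_1,\alpha_2,\alpha_3)$ and $\beta=(\beta_1,\beta_2,\beta_3)$, then $$\alpha\cdot(\mathbf{x}(u,v)\times\mu(u,v))+\beta\cdot\mu(u,v)=0.$$
   Context: Standing assumptions: $S$ is a real irreducible algebraic surface in $\mathbb{R}^3$ (with 2-dimensional real part) whose Gaussian curvature is not identically zero. Canonical affine rotation groups about the $z$-axis (parameter $t\in\mathbb{R}$): elliptic $\begin{pmatrix}\cos t&-\sin t&0\\ \sin t&\cos t&0\\0&0&1\end{pmatrix}$, hyperbolic $\begin{pmatrix}\cosh t&\sinh t&0\\ \sinh t&\cosh t&0\\0&0&1\end{pmatrix}$, parabolic $\begin{pmatrix}1&0&0\\ t&1&0\\ t^2/2&t&1\end{pmatrix}$. $S$ is an affine rotation surface about a line $\mathcal{A}$ (its axis) if there is a rigid motion $T$ of $\mathbb{R}^3$ carrying $\mathcal{A}$ to the $z$-axis such that $T(S)$ is invariant under one of these three groups. Plücker coordinates: a line through a point $Q$ (identified with its position vector) with direction vector $\mathbf{w}\ne0$ has Plücker coordinates $(\bar{\mathbf{w}},\mathbf{w})\in\mathbb{R}^6$, $\bar{\mathbf{w}}=Q\times\mathbf{w}$. Thus $\alpha$ is a direction vector of $\mathcal{A}$ and $\beta=Q\times\alpha$ for $Q\in\mathcal{A}$. The vector $\mu$: let $\Delta(u,v)$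 be the product of the determinants of the first and second fundamental forms of $\mathbf{x}(u,v)$ (a rational function). The affine co-normal vector is $\nu=|K|^{-1/4}\mathbf{N}=|\Delta|^{-1/4}(\mathbf{x}_u\times\mathbf{x}_v)$, with $\mathbf{N}$ the unit normal and $K$ the Gaussian curvature. One has $\nu_u\times\nu_v=|\Delta|^{-3/2}\Phi$, where $\Phi=\Phi(u,v)$ has rational components (up to sign), and $\mu=\dfrac{\Phi}{(\mathbf{x}_u\times\mathbf{x}_v)\cdot\Phi}$, which has rational components in $u,v$ and is parallel to the affine normal vector $\xi=[\nu,\nu_u,\nu_v]^{-1}(\nu_u\times\nu_v)$ of $S$ at $\mathbf{x}(u,v)$, where $[\cdot,\cdot,\cdot]$ is the determinant. The identity is an identity of rational functions in $u,v$. *)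

(* Defs.v *)
From HB Require Import structures.
From mathcomp Require Import all_boot all_order all_algebra.
From mathcomp Require Import all_classical all_reals all_analysis.
From mathcomp Require mpoly.
(* Needed for the ring structures on mpoly; its notations clash with those of
   MathComp-Analysis. *)
Import -(notations) mpoly.

Set Implicit Arguments.
Unset Strict Implicit.
Unset Printing Implicit Defensive.

Import Order.TTheory GRing.Theory Num.Theory.
Import numFieldNormedType.Exports.

Local Open Scope classical_set_scope.
Local Open Scope ring_scope.

Section Vectors.
Variable R : realType.

Definition vec3 (a b c : R) : 'cV[R]_3 := \col_i [:: a; b; c]`_i.

Definition rows3 (rows : seq (seq R)) : 'M[R]_3 :=
  \matrix_(i, j) (nth [::] rows i)`_j.

Definition dot (a b : 'cV[R]_3) : R := \sum_i a i 0 * b i 0.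

(* Indices are taken in 'I_3 = Z/3, so that i + 1 and i + 2 are the cyclic
   successors of i. *)
Definition cross (a b : 'cV[R]_3) : 'cV[R]_3 :=
  \col_i (a (i + 1) 0 * b (i + 2) 0 - a (i + 2) 0 * b (i + 1) 0).

Definition enorm (a : 'cV[R]_3) : R := Num.sqrt (dot a a).

End Vectors.

Section AlgebraicSurfaces.
Variable R : realType.

Definition irreducible_mpoly (n : nat) (F : mpoly.mpoly n R) : Prop :=
  [/\ F != 0, F \isn't a GRing.unit &
      forall G H : mpoly.mpoly n R, F = G * H ->
        G \is a GRing.unit \/ H \is a GRing.unit].

Definition peval3 (F : mpoly.mpoly 3 R) (p : 'cV[R]_3) : R :=
  mpoly.meval (fun i => p i 0) F.

Definition zero_locus (F : mpoly.mpoly 3 R) : set 'cV[R]_3 :=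
  [set p | peval3 F p = 0].

(* The zero locus of a nonzero polynomial in three variables has dimension at
   most 2, so it is enough to ask for a 2-dimensional cell: a continuous
   injection of a nonempty open subset of the plane restricts to a
   homeomorphism of a closed disc onto its image. *)
Definition two_dimensional (S : set 'cV[R]_3) : Prop :=
  exists (U : set 'cV[R]_2) (phi : 'cV[R]_2 -> 'cV[R]_3),
    [/\ open U, U !=set0, {within U, continuous phi},
        set_inj U phi & phi @` U `<=` S].

Definition irreducible_surface (S : set 'cV[R]_3) : Prop :=
  (exists2 F : mpoly.mpoly 3 R, irreducible_mpoly F & S = zero_locus F) /\
  two_dimensional S.

End AlgebraicSurfaces.

Section RationalParametrizations.
Variable R : realType.

(* A triple of rational functions of (u, v), each one given by a numerator and
   a nonzero denominator. *)
Definition rat_param := 'I_3 -> {ratio (mpoly.mpoly 2 R)}.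

Definition peval2 (P : mpoly.mpoly 2 R) (u v : R) : R :=
  mpoly.meval (fun i : 'I_2 => [:: u; v]`_i) P.

Definition param_dom (x : rat_param) (u v : R) : Prop :=
  forall i, peval2 (frac (x i)).2 u v != 0.

(* Meaningful only on [param_dom x], as division by 0 returns 0. *)
Definition param_fun (x : rat_param) (u v : R) : 'cV[R]_3 :=
  \col_i (peval2 (frac (x i)).1 u v / peval2 (frac (x i)).2 u v).

(* The image lies in S and is Zariski dense in S (it need not be all of S). *)
Definition parametrizes (x : rat_param) (S : set 'cV[R]_3) : Prop :=
  (forall u v, param_dom x u v -> S (param_fun x u v)) /\
  (forall G : mpoly.mpoly 3 R,
     (forall u v, param_dom x u v -> peval3 G (param_fun x u v) = 0) ->
     forall p, S p -> peval3 G p = 0).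

End RationalParametrizations.

Section DifferentialGeometry.
Variable R : realType.

Definition du (V : normedModType R) (f : R -> R -> V) (u v : R) : V :=
  derive1 (fun s => f s v) u.

Definition dv (V : normedModType R) (f : R -> R -> V) (u v : R) : V :=
  derive1 (fun s => f u s) v.

Variable x : R -> R -> 'cV[R]_3.

Definition cross_uv (u v : R) : 'cV[R]_3 := cross (du x u v) (dv x u v).

Definition unit_normal (u v : R) : 'cV[R]_3 :=
  (enorm (cross_uv u v))^-1 *: cross_uv u v.

Definition det_first_form (u v : R) : R :=
  dot (du x u v) (du x u v) * dot (dv x u v) (dv x u v)
  - dot (du x u v) (dv x u v) ^+ 2.

Definition det_second_form (u v : R) : R :=
  dot (du (du x) u v) (unit_normal u v) * dot (dv (dv x) u v) (unit_normal u v)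
  - dot (dv (du x) u v) (unit_normal u v) ^+ 2.

Definition gauss_curvature (u v : R) : R :=
  det_second_form u v / det_first_form u v.

Definition Delta (u v : R) : R := det_first_form u v * det_second_form u v.

Definition conormal (u v : R) : 'cV[R]_3 :=
  (`|gauss_curvature u v| `^ (- 4^-1)) *: unit_normal u v.

(* Defined by nu_u x nu_v = |Delta|^(-3/2) Phi. *)
Definition Phi (u v : R) : 'cV[R]_3 :=
  (`|Delta u v| `^ (3 / 2)) *: cross (du conormal u v) (dv conormal u v).

Definition mu (u v : R) : 'cV[R]_3 :=
  (dot (cross_uv u v) (Phi u v))^-1 *: Phi u v.

End DifferentialGeometry.

Section AffineRotation.
Variable R : realType.

Definition cosh (t : R) : R := (expR t + expR (- t)) / 2.
Definition sinh (t : R) : R := (expR t - expR (- t)) / 2.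

Definition elliptic_rot (t : R) : 'M[R]_3 :=
  rows3 [:: [:: cos t; - sin t; 0]; [:: sin t; cos t; 0]; [:: 0; 0; 1]].

Definition hyperbolic_rot (t : R) : 'M[R]_3 :=
  rows3 [:: [:: cosh t; sinh t; 0]; [:: sinh t; cosh t; 0]; [:: 0; 0; 1]].

Definition parabolic_rot (t : R) : 'M[R]_3 :=
  rows3 [:: [:: 1; 0; 0]; [:: t; 1; 0]; [:: t ^+ 2 / 2; t; 1]].

Definition invariant_under (G : R -> 'M[R]_3) (S : set 'cV[R]_3) : Prop :=
  forall t, (fun p => G t *m p) @` S = S.

Definition rigid_motion (T : 'cV[R]_3 -> 'cV[R]_3) : Prop :=
  exists (O : 'M[R]_3) (b : 'cV[R]_3),
    [/\ O *m O^T = 1%:M, \det O = 1 & forall p, T p = O *m p + b].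

Definition line (Q w : 'cV[R]_3) : set 'cV[R]_3 :=
  [set p | exists s : R, p = Q + s *: w].

Definition z_axis : set 'cV[R]_3 := line 0 (vec3 0 0 1).

Definition affine_rotation_surface (S A : set 'cV[R]_3) : Prop :=
  exists T : 'cV[R]_3 -> 'cV[R]_3,
    [/\ rigid_motion T, T @` A = z_axis &
        [\/ invariant_under elliptic_rot (T @` S),
            invariant_under hyperbolic_rot (T @` S) |
            invariant_under parabolic_rot (T @` S)]].

(* (wbar, w) are Plücker coordinates of the line A; they are determined by A
   up to a common nonzero factor. *)
Definition plucker_coordinates (A : set 'cV[R]_3) (wbar w : 'cV[R]_3) : Prop :=
  w != 0 /\ exists2 Q, A = line Q w & wbar = cross Q w.

End AffineRotation.

(* Main.v *)
Require Import Defs.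
From HB Require Import structures.
From mathcomp Require Import all_boot all_order all_algebra.
From mathcomp Require Import all_classical all_reals all_analysis.
From mathcomp Require mpoly.
Import -(notations) mpoly.
From mathcomp Require Import ring lra.

Set Implicit Arguments.
Unset Strict Implicit.
Unset Printing Implicit Defensive.

Import Order.TTheory GRing.Theory Num.Theory.
Import numFieldNormedType.Exports.

Local Open Scope classical_set_scope.
Local Open Scope ring_scope.

(** The affine conormal nu transforms by the inverse transpose under volume
    preserving affine maps; the proof is the infinitesimal form of this fact,
    applied to the group of rotations.

    Each rotation group preserves volume and fixes its axis pointwise, so in
    the original coordinates its velocity at a point r is M (r - q0), where q0
    lies on the axis, tr M = 0 and the kernel of M is the line of alpha
    ([axial_symmetry_field]). This field is tangent to the surface
    ([invariant_field_tangent]); write it M (x - q0) = p x_u + q x_v at the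
    point considered. Invariance of the surface then yields
    p nu_u + q nu_v = - M^T nu ([conormal_equivariant]).

    Consequently the functions alpha . nu and (x - q0) . nu are stationary in
    the direction (p, q): the derivative of the first is - (M alpha) . nu = 0,
    that of the second is - M (x - q0) . nu = 0, as x_u . nu = x_v . nu = 0.
    If (p, q) is nonzero, their Jacobian determinant in (u, v) vanishes. This
    determinant is (alpha x (x - q0)) . (nu_u x nu_v), and mu is a multiple of
    nu_u x nu_v, so the affine normal line meets the axis or is parallel to
    it, which is the claim. If (p, q) = 0, the point lies on the axis and
    alpha x (x - q0) = 0.

    Tangency is proved algebraically, without regular points or implicit
    functions. Polynomials vanishing on S are stable under the Lie derivative
    along the velocity field. If the determinant of x_u, x_v and the field
    were not identically zero, they would be stable under all partial
    derivatives as well, since a gradient orthogonal to three independent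
    vectors is zero; as differentiation lowers the degree, only the zero
    polynomial would then vanish on S. That the determinant may be cancelled
    uses that rational functions of (u, v) form a domain
    ([regular_mul_eq0]).

    The equivariance of nu is linear algebra on the third order jet of x
    ([invariant_jet]): with n = x_u x x_v and D the determinant of the
    second fundamental form computed with n in place of the unit normal, one
    has nu = |D|^(-1/4) n, and the derivatives of n and D along (p, q) involve
    the same divergence c, namely - M^T n - c n and - 4 c D; the exponent -1/4
    is the one that makes c cancel. *)

(** * Sets of polynomials stable under differentiation *)

Section DifferentialIdeals.
Variables (R : realType) (n : nat).
Implicit Types (P : mpoly.mpoly n R) (I : mpoly.mpoly n R -> Prop).

Lemma msize_mderiv i P : (msize (mderiv i P) <= (msize P).-1)%N.
Proof.
rewrite msizeE; apply/bigmax_leqP_seq => m mP _.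
have : mnm_add m (mnm1 i) \in msupp P.
  rewrite mcoeff_msupp; apply: contraTN mP => /eqP Pm0.
  by rewrite mcoeff_msupp mcoeff_mderiv Pm0 mul0rn eqxx.
by move=> /msize_mdeg_lt; rewrite mdegD mdeg1 addn1; case: (msize P).
Qed.

Lemma mderiv_eq0_mpolyC P :
  (forall i, mderiv i P = 0) -> P = @mpolyC n R (mcoeff (@mnm0 n) P).
Proof.
move=> dP0; apply/mpolyP => m; rewrite mcoeffC.
have [-> | m0] := eqVneq m (@mnm0 n); first by rewrite mulr1.
have [i mi] : exists i, m i != 0%N.
  apply/existsP; apply: contraNT m0 => /existsPn m0.
  by apply/eqP/mnmP => i; rewrite mnm0E; move: (m0 i); rewrite negbK => /eqP.
have := mcoeff_mderiv i P (mnm_sub m (mnm1 i)).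
rewrite dP0 mcoeff0 submK; last by rewrite lep1mP.
by move/esym/eqP; rewrite mulrn_eq0 /= mulr0 => /eqP.
Qed.

(** Differentiation lowers the degree, so by induction the partial derivatives
    of a member of [I] are zero and the member is a constant. *)
Lemma mderiv_stable_eq0 I :
    (forall P i, I P -> I (mderiv i P)) ->
    (forall c, I (@mpolyC n R c) -> c = 0) ->
  forall P, I P -> P = 0.
Proof.
move=> Ider Icst P; have [k] := ubnP (msize P).
elim: k P => // k IHk P; rewrite ltnS => Pk IP.
have [P0 | PN0] := posnP (msize P).
  by apply/eqP; rewrite -msize_poly_eq0 P0.
have dP0 i : mderiv i P = 0.
  apply: IHk (Ider _ i IP); apply: leq_ltn_trans (msize_mderiv i P) _.
  by apply: leq_trans Pk; rewrite prednK.
move: IP; rewrite (mderiv_eq0_mpolyC dP0) => /Icst ->; exact: mpolyC0.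
Qed.

End DifferentialIdeals.

(** * The chain rule along a curve *)

Lemma derivable_neq0_near (R : realType) (f : R -> R) (t df : R) :
  is_derive t (1 : R) f df -> f t != 0 -> \forall s \near t, f s != 0.
Proof.
move=> [+ _] ft; move=> /derivable1_diffP/differentiable_continuous fc.
exact: cvgr_neq0 fc ft.
Qed.

Section ChainRule.
Variables (R : realType) (n : nat).

Lemma is_derive_meval (g : R -> 'I_n -> R) (dg : 'I_n -> R) (t : R) :
    (forall i, is_derive t 1 (fun s => g s i) (dg i)) ->
  forall P : mpoly.mpoly n R,
    is_derive t 1 (fun s => meval (g s) P)
      (\sum_i meval (g t) (mderiv i P) * dg i).
Proof.
move=> g_dg.
pose chain (P : mpoly.mpoly n R) := is_derive t 1 (fun s => meval (g s) P)
  (\sum_i meval (g t) (mderiv i P) * dg i).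
have chainC c : chain (@mpolyC n R c).
  rewrite /chain (_ : (fun s => _) = cst c); last first.
    by apply/funext => s; rewrite mevalC.
  rewrite big1 => [|i _]; first exact: is_derive_cst.
  by rewrite mderivC meval0 mul0r.
have chainM P1 P2 : chain P1 -> chain P2 -> chain (P1 * P2).
  rewrite /chain => dP1 dP2; rewrite (_ : (fun s => _) =
    (fun s => meval (g s) P1) * (fun s => meval (g s) P2)); last first.
    by apply/funext => s; rewrite mevalM.
  apply: is_derive_eq; rewrite /GRing.scale /= !mulr_sumr -big_split /=.
  by apply: eq_bigr => i _; rewrite mderivM mevalD !mevalM; ring.
have chainX i : chain (mpolyX R (mnm1 i)).
  rewrite /chain (_ : (fun s => _) = g^~ i); last first.
    by apply/funext => s; rewrite mevalXU.
  apply: is_derive_eq; rewrite (bigD1 i) //= big1 => [|j /negPf ji].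
    rewrite mderivX mnm1E eqxx scale1r (_ : mnm_sub _ _ = @mnm0 n).
      by rewrite mpolyX0 meval1; ring.
    by apply/mnmP => j; rewrite !mnmE subnn.
  by rewrite mderivX mnm1E eq_sym ji scale0r meval0 mul0r.
have chainXm m : chain (mpolyX R m).
  rewrite mpolyXE_id; apply: big_ind => [||i _] //; first exact: (chainC 1).
  elim: (m i) => [|k IHk]; first exact: (chainC 1).
  by rewrite exprS; exact: chainM.
move=> P; elim/mpolyind: P => [|c m P _ _ chainP].
  by rewrite -mpolyC0; exact: chainC.
rewrite -mul_mpolyC -/(chain _).
have chain_cm : chain (mpolyC n c * mpolyX R m) by exact: chainM.
move: chain_cm chainP; rewrite /chain => chain_cm chainP.
rewrite (_ : (fun s => _) = (fun s => meval (g s) (mpolyC n c * mpolyX R m))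
    + (fun s => meval (g s) P)); last by apply/funext => s; rewrite mevalD.
apply: is_derive_eq; rewrite -big_split /=.
by apply: eq_bigr => i _; rewrite mderivD mevalD mulrDl.
Qed.

End ChainRule.

(** * Partial derivatives of rational functions of two variables *)

Section PartialDerivatives.
Variable R : realType.

(** The boolean selects the variable, so that the two partial derivatives are
    treated at once: [partial b f u v] is the derivative of [slice b f u v] at
    [slot b u v]. *)
Definition partial (b : bool) (V : normedModType R) (f : R -> R -> V) :
  R -> R -> V := if b then dv f else du f.

Definition slice (b : bool) (V : Type) (f : R -> R -> V) (u v : R) : R -> V :=
  if b then f u else f^~ v.

Definition slot (b : bool) (u v : R) : R := if b then v else u.

Lemma partialE b (V : normedModType R) (f : R -> R -> V) u v :
  partial b f u v = derive1 (slice b f u v) (slot b u v).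
Proof. by case: b. Qed.

Lemma slice_slot b (V : Type) (f : R -> R -> V) u v :
  slice b f u v (slot b u v) = f u v.
Proof. by case: b. Qed.

Definition var (b : bool) : 'I_2 := if b then 1 else 0.

Lemma is_derive_peval2 b (P : mpoly.mpoly 2 R) u v :
  is_derive (slot b u v) (1 : R) (slice b (peval2 P) u v : R -> R)
    (peval2 (mderiv (var b) P) u v).
Proof.
pose g := slice b (fun u v => fun i : 'I_2 => [:: u; v]`_i) u v.
have dg i : is_derive (slot b u v) 1 (fun s => g s i) ((i == var b)%:R : R).
  case: (i) => [[|[|//]]] Hi; rewrite /g /slot /slice /var; case: b {g} => /=;
    rewrite -?[_ == _]/false -?[_ == _]/true /=;
    by [exact: is_derive_id | exact: is_derive_cst].
have := is_derive_meval dg P.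
rewrite (_ : (fun s => meval (g s) P) = slice b (peval2 P) u v); last first.
  by rewrite /g; case: (b).
move/is_derive_eq; apply; rewrite (bigD1 (var b)) //= eqxx mulr1 big1.
  by rewrite addr0 /g slice_slot.
by move=> i /negPf ->; rewrite mulr0.
Qed.

End PartialDerivatives.

Section RegularFunctions.
Variables (R : realType) (Q : mpoly.mpoly 2 R).
Implicit Types f g : R -> R -> R.

Definition off_zeros (u v : R) : Prop := peval2 Q u v != 0.

(** The localization of the polynomial ring at the powers of [Q], as functions
    known only where [Q] is nonzero. The exponent [k.+1] is always positive, so
    that the derivative of the denominator has a uniform form. *)
Definition regular f : Prop := exists (P : mpoly.mpoly 2 R) (k : nat),
  forall u v, off_zeros u v -> f u v = peval2 P u v / peval2 Q u v ^+ k.+1.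

Lemma peval2D P1 P2 (u v : R) :
  peval2 (P1 + P2) u v = peval2 P1 u v + peval2 P2 u v.
Proof. exact: mevalD. Qed.

Lemma peval2M P1 P2 (u v : R) :
  peval2 (P1 * P2) u v = peval2 P1 u v * peval2 P2 u v.
Proof. exact: mevalM. Qed.

Lemma peval2X P k (u v : R) : peval2 (P ^+ k) u v = peval2 P u v ^+ k.
Proof. by rewrite /peval2 rmorphXn. Qed.

Lemma peval2C c (u v : R) : peval2 (@mpolyC 2 R c) u v = c.
Proof. exact: mevalC. Qed.

Lemma regular_eq f g :
  (forall u v, off_zeros u v -> f u v = g u v) -> regular f -> regular g.
Proof.
by move=> fg [P [k fP]]; exists P, k => u v uv; rewrite -fg ?fP.
Qed.

Lemma regular_cst (c : R) : regular (fun _ _ => c).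
Proof.
by exists (mpolyC 2 c * Q), 0 => u v uv; rewrite peval2M peval2C expr1 mulfK.
Qed.

Lemma regularD f g :
  regular f -> regular g -> regular (fun u v => f u v + g u v).
Proof.
move=> [P [k fP]] [P' [k' gP']].
exists (P * Q ^+ k'.+1 + P' * Q ^+ k.+1), (k + k'.+1)%N => u v uv.
rewrite fP // gP' // peval2D !peval2M !peval2X addf_div ?expf_neq0 //.
by rewrite -exprD addSn.
Qed.

Lemma regularM f g :
  regular f -> regular g -> regular (fun u v => f u v * g u v).
Proof.
move=> [P [k fP]] [P' [k' gP']].
exists (P * P'), (k + k'.+1)%N => u v uv.
by rewrite fP // gP' // peval2M mulf_div -exprD addSn.
Qed.

Lemma regularB f g :
  regular f -> regular g -> regular (fun u v => f u v - g u v).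
Proof.
move=> rf rg; apply: regular_eq (regularD rf (regularM (regular_cst (-1)) rg)).
by move=> u v _; rewrite mulN1r.
Qed.

Lemma off_zeros_near b u v : off_zeros u v ->
  \forall s \near slot b u v, slice b (peval2 Q) u v s != 0.
Proof.
move=> Quv; apply: (derivable_neq0_near (is_derive_peval2 b Q u v)).
by rewrite slice_slot.
Qed.

Lemma partial_eq b (V : normedModType R) (f g : R -> R -> V) u v :
    (forall u v, off_zeros u v -> f u v = g u v) ->
  off_zeros u v -> partial b f u v = partial b g u v.
Proof.
move=> fg uv; rewrite !partialE !derive1E; apply: near_eq_derive.
by move: (off_zeros_near b uv); apply: filterS; case: b => s; exact: fg.
Qed.

(** The numerator over [Q ^+ k.+2] of a partial derivative of
    [P / Q ^+ k.+1]. *)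
Definition quotient_num b k (P : mpoly.mpoly 2 R) : mpoly.mpoly 2 R :=
  mderiv (var b) P * Q - (P * mderiv (var b) Q) *+ k.+1.

Lemma quotient_numC b c k P :
  quotient_num b k.+1 (quotient_num c k P) =
  quotient_num c k.+1 (quotient_num b k P).
Proof.
have symmetric (A : comNzRingType) (p pb pc pbc q qb qc qbc : A) m :
  (pbc * q + pc * qb - (pb * qc + p * qbc) *+ m.+1) * q
    - (pc * q - p * qc *+ m.+1) * qb *+ m.+2 =
  (pbc * q + pb * qc - (pc * qb + p * qbc) *+ m.+1) * q
    - (pb * q - p * qb *+ m.+1) * qc *+ m.+2.
  by ring.
rewrite /quotient_num !mderivB !mderivMn !mderivM.
rewrite (mderiv_comm (var b) (var c) P) (mderiv_comm (var b) (var c) Q).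
exact: symmetric.
Qed.

Lemma is_derive_quotient b f P k u v :
    (forall u v, off_zeros u v -> f u v = peval2 P u v / peval2 Q u v ^+ k.+1) ->
  off_zeros u v ->
  is_derive (slot b u v) (1 : R) (slice b f u v)
    (peval2 (quotient_num b k P) u v
     / peval2 Q u v ^+ k.+2).
Proof.
move=> fP uv.
have Qs : slice b (peval2 Q) u v (slot b u v) != 0 by rewrite slice_slot.
have dP := is_derive_peval2 b P u v; have dQ := is_derive_peval2 b Q u v.
have dQk := is_deriveX k.+1 dQ.
have Qks : (slice b (peval2 Q) u v ^+ k.+1) (slot b u v) != 0.
  by rewrite exprfctE expf_neq0.
have dQV := is_deriveV Qks dQk.
have dPQ := is_deriveM dP dQV.
apply: (@near_eq_is_derive _ _ _
  (slice b (peval2 P) u v *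
    (fun s => ((slice b (peval2 Q) u v ^+ k.+1) s)^-1))).
  move: (off_zeros_near b uv); apply: filterS.
  by case: b {Qs dP dQ dQk Qks dQV dPQ} => s sQ; rewrite /= fP //= exprfctE.
apply: is_derive_eq.
rewrite !exprfctE !slice_slot /GRing.scale /= /quotient_num /peval2.
rewrite mevalB mevalMn !mevalM.
rewrite -!/(peval2 _ u v) -mulr_natr !exprS.
have Quv : peval2 Q u v != 0 by [].
have Qk : peval2 Q u v ^+ k != 0 by rewrite expf_neq0.
by field; rewrite Qk.
Qed.

Lemma is_derive_regular b f u v : regular f -> off_zeros u v ->
  is_derive (slot b u v) (1 : R) (slice b f u v) (partial b f u v).
Proof.
move=> [P [k fP]] uv; have df := is_derive_quotient b fP uv.
by apply: (is_derive_eq df); rewrite partialE derive1E derive_val.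
Qed.

Lemma partial_quotient b f P k u v :
    (forall u v, off_zeros u v -> f u v = peval2 P u v / peval2 Q u v ^+ k.+1) ->
  off_zeros u v -> partial b f u v =
    peval2 (quotient_num b k P) u v
     / peval2 Q u v ^+ k.+2.
Proof.
move=> fP uv; have df := is_derive_quotient b fP uv.
by rewrite partialE derive1E derive_val.
Qed.

Lemma regular_partial b f : regular f -> regular (partial b f).
Proof.
move=> [P [k fP]]; eexists _, k.+1 => u v uv; exact: partial_quotient fP uv.
Qed.

(** For rational functions this reduces to the commutation of formal
    derivatives, through [quotient_numC]. *)
Lemma partialC b c f u v : regular f -> off_zeros u v ->
  partial b (partial c f) u v = partial c (partial b f) u v.
Proof.
move=> [P [k fP]] uv.
have df d u' v' : off_zeros u' v' -> partial d f u' v' =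
    peval2 (quotient_num d k P) u' v' / peval2 Q u' v' ^+ k.+2.
  exact: partial_quotient.
rewrite (partial_quotient b (df c) uv) (partial_quotient c (df b) uv).
by rewrite quotient_numC.
Qed.

Lemma partial_cst b (V : normedModType R) (c : V) u v :
  partial b (fun _ _ => c) u v = 0.
Proof. by rewrite partialE; case: b; exact: derive1_cst. Qed.

Lemma partialD b f g u v : regular f -> regular g -> off_zeros u v ->
  partial b (fun u v => f u v + g u v) u v = partial b f u v + partial b g u v.
Proof.
move=> rf rg uv.
have df := is_derive_regular b rf uv; have dg := is_derive_regular b rg uv.
rewrite partialE derive1E (_ : slice b _ u v = slice b f u v + slice b g u v).
  by rewrite derive_val.
by case: (b).
Qed.

Lemma partialM b f g u v : regular f -> regular g -> off_zeros u v ->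
  partial b (fun u v => f u v * g u v) u v =
    partial b f u v * g u v + f u v * partial b g u v.
Proof.
move=> rf rg uv.
have df := is_derive_regular b rf uv; have dg := is_derive_regular b rg uv.
rewrite partialE derive1E (_ : slice b _ u v = slice b f u v * slice b g u v).
  by rewrite derive_val !slice_slot /GRing.scale /=; ring.
by case: (b).
Qed.

Lemma partialZ b c f u v : regular f -> off_zeros u v ->
  partial b (fun u v => c * f u v) u v = c * partial b f u v.
Proof.
by move=> rf uv; rewrite partialM ?partial_cst ?mul0r ?add0r //;
  exact: regular_cst.
Qed.

Lemma partialB b f g u v : regular f -> regular g -> off_zeros u v ->
  partial b (fun u v => f u v - g u v) u v = partial b f u v - partial b g u v.
Proof.
move=> rf rg uv.
have df := is_derive_regular b rf uv; have dg := is_derive_regular b rg uv.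
rewrite partialE derive1E (_ : slice b _ u v = slice b f u v - slice b g u v).
  by rewrite derive_val.
by case: (b).
Qed.

Lemma partial_det c f g (h : R -> R -> R) u v (df dg dh : R) :
    regular f -> regular g -> regular h -> off_zeros u v ->
    partial c f u v = df -> partial c g u v = dg -> partial c h u v = dh ->
  partial c (fun u v => f u v * g u v - h u v ^+ 2) u v =
    df * g u v + f u v * dg - 2 * h u v * dh.
Proof.
move=> rf rg rh uv <- <- <-.
rewrite (partialB c (regularM rf rg) (regularM rh rh) uv).
by rewrite (partialM c rf rg uv) (partialM c rh rh uv); ring.
Qed.

(** Polynomials with vanishing values are stable under differentiation, because
    formal derivatives evaluate to actual ones. *)
Lemma peval2_eq0 (P : mpoly.mpoly 2 R) :
  (forall u v, peval2 P u v = 0) -> P = 0.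
Proof.
move: P; apply: mderiv_stable_eq0 => [P i P0 u v | c c0].
  have [b ->] : exists b, i = var b.
    case: i => [[|[|//]] Hi]; [exists false | exists true]; exact: val_inj.
  have dP := is_derive_peval2 b P u v.
  rewrite -[LHS]derive_val (_ : slice b _ u v = cst 0) ?derive_cst //.
  by apply/funext => s; case: (b); rewrite /= P0.
by rewrite -(c0 0 0) peval2C.
Qed.

Hypothesis Q_neq0 : Q != 0.

Lemma regular_mul_eq0 f g : regular f -> regular g ->
    (forall u v, off_zeros u v -> f u v * g u v = 0) ->
  (forall u v, off_zeros u v -> f u v = 0) \/
  (forall u v, off_zeros u v -> g u v = 0).
Proof.
move=> [P [k fP]] [P' [k' gP']] fg0.
(* The factor [Q] makes the product vanish also at the zeros of [Q]. *)
have : P * P' * Q = 0.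
  apply: peval2_eq0 => u v; rewrite !peval2M.
  have [-> | uv] := eqVneq (peval2 Q u v) 0; first by rewrite mulr0.
  have /eqP := fg0 u v uv.
  rewrite fP // gP' // mulf_div -exprD mulf_eq0 invr_eq0.
  by rewrite expf_eq0 (negPf uv) andbF orbF => /eqP ->; rewrite mul0r.
move/eqP; rewrite !mulf_eq0 (negPf Q_neq0) orbF => /orP[] /eqP P0.
  by left=> u v uv; rewrite fP // P0 /peval2 meval0 mul0r.
by right=> u v uv; rewrite gP' // P0 /peval2 meval0 mul0r.
Qed.

End RegularFunctions.

(** * Vector algebra in dimension three *)

Section VectorAlgebra.
Variable R : realType.
Implicit Types a b c w : 'cV[R]_3.

Lemma sum3 (V : nmodType) (F : 'I_3 -> V) : \sum_i F i = F 0 + F 1 + F 2%:R.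
Proof.
rewrite !big_ord_recr big_ord0 /= add0r.
by congr (F _ + F _ + F _); apply: val_inj.
Qed.

Lemma cV3P a b :
  a 0 0 = b 0 0 -> a 1 0 = b 1 0 -> a 2%:R 0 = b 2%:R 0 -> a = b.
Proof.
move=> e0 e1 e2; apply/colP => -[[|[|[|//]]] Hi].
- by rewrite (_ : Ordinal Hi = 0) //; apply: val_inj.
- by rewrite (_ : Ordinal Hi = 1) //; apply: val_inj.
- by rewrite (_ : Ordinal Hi = 2%:R) //; apply: val_inj.
Qed.

Lemma dotE a b : dot a b = a 0 0 * b 0 0 + a 1 0 * b 1 0 + a 2%:R 0 * b 2%:R 0.
Proof. exact: sum3. Qed.

Lemma cross0E a b : cross a b 0 0 = a 1 0 * b 2%:R 0 - a 2%:R 0 * b 1 0.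
Proof. by rewrite mxE add0r add0r. Qed.

Lemma cross1E a b : cross a b 1 0 = a 2%:R 0 * b 0 0 - a 0 0 * b 2%:R 0.
Proof.
by rewrite mxE; congr (a _ 0 * b _ 0 - a _ 0 * b _ 0); apply: val_inj.
Qed.

Lemma cross2E a b : cross a b 2%:R 0 = a 0 0 * b 1 0 - a 1 0 * b 0 0.
Proof.
by rewrite mxE; congr (a _ 0 * b _ 0 - a _ 0 * b _ 0); apply: val_inj.
Qed.

Lemma mulmx_cV3E (M : 'M[R]_3) a i :
  (M *m a) i 0 = M i 0 * a 0 0 + M i 1 * a 1 0 + M i 2%:R * a 2%:R 0.
Proof. by rewrite mxE sum3. Qed.

Lemma cV_addE a b i : (a + b) i 0 = a i 0 + b i 0. Proof. by rewrite mxE. Qed.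

Lemma cV_oppE a i : (- a) i 0 = - a i 0. Proof. by rewrite mxE. Qed.

Lemma cV_scaleE k a i : (k *: a) i 0 = k * a i 0. Proof. by rewrite mxE. Qed.

Definition coordE := (cV_addE, cV_oppE, cV_scaleE, cross0E, cross1E, cross2E,
  dotE, mulmx_cV3E).

Lemma dotDl a b c : dot (a + b) c = dot a c + dot b c.
Proof. by rewrite !coordE; ring. Qed.

Lemma dotDr a b c : dot c (a + b) = dot c a + dot c b.
Proof. by rewrite !coordE; ring. Qed.

Lemma dotNl a b : dot (- a) b = - dot a b.
Proof. by rewrite !coordE; ring. Qed.

Lemma dotNr a b : dot a (- b) = - dot a b.
Proof. by rewrite !coordE; ring. Qed.

Lemma dotZl k a b : dot (k *: a) b = k * dot a b.
Proof. by rewrite !coordE; ring. Qed.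

Lemma dotZr k a b : dot a (k *: b) = k * dot a b.
Proof. by rewrite !coordE; ring. Qed.

Definition dot_linE := (dotDl, dotDr, dotNl, dotNr, dotZl, dotZr).

Lemma dot_mulmx (M : 'M[R]_3) a b : dot (M *m a) b = dot a (M^T *m b).
Proof. by rewrite !coordE ?mxE; ring. Qed.

Lemma dot_self_ge0 a : 0 <= dot a a.
Proof. by rewrite dotE !addr_ge0 // -expr2 sqr_ge0. Qed.

Lemma dot_self_eq0 a : (dot a a == 0) = (a == 0).
Proof.
apply/eqP/eqP => [|->]; last by rewrite dotE !mxE; ring.
rewrite dotE -!expr2 => /eqP.
rewrite !paddr_eq0 ?addr_ge0 ?sqr_ge0 // !sqrf_eq0.
by case/andP=> /andP[/eqP a0 /eqP a1] /eqP a2; apply: cV3P; rewrite mxE.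
Qed.

Lemma lagrange_identity a b :
  dot a a * dot b b - dot a b ^+ 2 = dot (cross a b) (cross a b).
Proof. by rewrite !coordE; ring. Qed.

Lemma dot_cross_l a b : dot a (cross a b) = 0.
Proof. by rewrite !coordE; ring. Qed.

Lemma dot_cross_r a b : dot b (cross a b) = 0.
Proof. by rewrite !coordE; ring. Qed.

Lemma tangent_decomposition a b w :
    cross a b != 0 -> dot w (cross a b) = 0 ->
  exists p q : R, w = p *: a + q *: b.
Proof.
set n := cross a b => n0 wn; have nn0 : dot n n != 0 by rewrite dot_self_eq0.
exists (dot (cross w b) n / dot n n), (dot (cross a w) n / dot n n).
have E : dot n n *: w =
  dot (cross w b) n *: a + dot (cross a w) n *: b + dot w n *: n.
  by apply: cV3P; rewrite !coordE; ring.
rewrite -[w in LHS](scalerK nn0) E wn scale0r addr0 scalerDr !scalerA.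
by rewrite ![_^-1 * _]mulrC.
Qed.

(** Derivative at the identity of the action of a matrix on cross products,
    which is by the cofactor matrix. *)
Lemma trace_cross (M : 'M[R]_3) a b :
  cross (M *m a) b + cross a (M *m b) =
    \tr M *: cross a b - M^T *m cross a b.
Proof. by apply: cV3P; rewrite /mxtrace !sum3 !coordE ?mxE; ring. Qed.

Lemma dot_cross_cross a b c w :
  dot (cross a b) (cross c w) = dot a c * dot b w - dot a w * dot b c.
Proof. by rewrite !coordE; ring. Qed.

Lemma dot0l a : dot 0 a = 0.
Proof. by rewrite dotE !mxE; ring. Qed.

Lemma dot_cross_parallel k a c : dot (cross a (k *: a)) c = 0.
Proof. by rewrite !coordE; ring. Qed.

Lemma orthogonal_to_frame (g : 'cV[R]_3) a b c i :
    dot g a = 0 -> dot g b = 0 -> dot g c = 0 ->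
  dot c (cross a b) * g i 0 = 0.
Proof.
move=> ga gb gc; rewrite -cV_scaleE.
have -> : dot c (cross a b) *: g =
    dot g a *: cross b c + dot g b *: cross c a + dot g c *: cross a b.
  by apply: cV3P; rewrite !coordE; ring.
by rewrite ga gb gc !scale0r !addr0 mxE.
Qed.

(** The left-hand side is the determinant with columns the inner products of
    [a] and [w] with [f] and [g], and (p, q) is in its kernel. *)
Lemma dot_cross_proportional a w (f g : 'cV[R]_3) (p q : R) :
    (p != 0) || (q != 0) ->
    dot a (p *: f + q *: g) = 0 -> dot w (p *: f + q *: g) = 0 ->
  dot (cross a w) (cross f g) = 0.
Proof.
move=> pq; rewrite !dot_linE dot_cross_cross => ea ew.
case/orP: pq => nz; apply: (mulfI nz); rewrite mulr0.
  have -> : p * (dot a f * dot w g - dot a g * dot w f) =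
    (p * dot a f + q * dot a g) * dot w g
      - (p * dot w f + q * dot w g) * dot a g by ring.
  by rewrite ea ew !mul0r subrr.
have -> : q * (dot a f * dot w g - dot a g * dot w f) =
  (p * dot w f + q * dot w g) * dot a f
    - (p * dot a f + q * dot a g) * dot w f by ring.
by rewrite ea ew !mul0r subrr.
Qed.

(** Translates the incidence condition in Plücker coordinates into coplanarity
    of the direction [a] of the line, the vector [w - q] from a point of the
    line, and [c]. *)
Lemma plucker_incidence a c w (q : 'cV[R]_3) :
  dot a (cross w c) + dot (cross q a) c = dot (cross a (w - q)) c.
Proof. by rewrite !coordE ?mxE; ring. Qed.

End VectorAlgebra.

(** * Jets of a surface invariant under a volume preserving field *)

Section InvariantJets.
(** The data are the values at one point: [X] stands for the position relative
    to a zero of the field, [x1], [x2], [x3] for the derivatives of the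
    parametrization, [n], [n1], [n2] for the normal x_u x x_v and its
    derivatives. The hypotheses [x1_n1] and [x1_n2] are the derivatives of the
    relation x_a . n = 0, and [X_n], [X_n1], [X_n2] are the tangency
    of the field and its derivatives. *)
Variables (R : realType) (M : 'M[R]_3) (X n : 'cV[R]_3).
Variables (x1 : bool -> 'cV[R]_3) (x2 : bool -> bool -> 'cV[R]_3).
Variable (x3 : bool -> bool -> bool -> 'cV[R]_3).
Variables (n1 : bool -> 'cV[R]_3) (n2 : bool -> bool -> 'cV[R]_3).

Hypothesis x2C : forall a b, x2 a b = x2 b a.
Hypothesis x3C12 : forall a b c, x3 a b c = x3 b a c.
Hypothesis x3C23 : forall a b c, x3 a b c = x3 a c b.

Hypothesis n_def : n = cross (x1 false) (x1 true).
Hypothesis n1_def : forall b,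
  n1 b = cross (x2 false b) (x1 true) + cross (x1 false) (x2 true b).
Hypothesis n_neq0 : n != 0.
Hypothesis x1_n1 : forall a b, dot (x2 a b) n + dot (x1 a) (n1 b) = 0.
Hypothesis x1_n2 : forall a b c,
  dot (x3 a b c) n + dot (x2 a b) (n1 c)
  + (dot (x2 a c) (n1 b) + dot (x1 a) (n2 b c)) = 0.

Hypothesis trM : \tr M = 0.
Hypothesis X_n : dot (M *m X) n = 0.
Hypothesis X_n1 : forall b, dot (M *m x1 b) n + dot (M *m X) (n1 b) = 0.
Hypothesis X_n2 : forall b c,
  dot (M *m x2 b c) n + dot (M *m x1 b) (n1 c)
  + (dot (M *m x1 c) (n1 b) + dot (M *m X) (n2 b c)) = 0.

Let h a b := dot (x2 a b) n.
Let h1 a b c := dot (x3 a b c) n + dot (x2 a b) (n1 c).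
Let D := h false false * h true true - h false true ^+ 2.
Let D1 c := h1 false false c * h true true + h false false * h1 true true c
  - 2 * h false true * h1 false true c.

(** If the coefficients p and q were extended to functions with
    M X = p x_u + q x_v, the flow of the vector field V = p d/du + q d/dv would
    lift to that of M, and c would be the divergence of V. The derivatives of p
    and q occur below as the tangential coefficients [J] of M x_a - V x_a, so
    that only their values at the point are needed. *)
Lemma invariant_jet : exists p q c : R,
  [/\ M *m X = p *: x1 false + q *: x1 true,
      p *: n1 false + q *: n1 true = - (M^T *m n) - c *: n &
      p * D1 false + q * D1 true = - 4 * c * D].
Proof.
have decomp w : dot w n = 0 -> exists p q : R, w = p *: x1 false + q *: x1 true.
  by move=> wn; apply: tangent_decomposition; rewrite -n_def.
have x1n a : dot (x1 a) n = 0.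
  by rewrite n_def; case: a; rewrite ?dot_cross_r ?dot_cross_l.
have [p [q MX]] := decomp _ X_n.
pose V (y : bool -> 'cV[R]_3) := p *: y false + q *: y true.
have [J J_def] : exists J : bool -> bool -> R, forall a,
    M *m x1 a - V (x2 a) = J a false *: x1 false + J a true *: x1 true.
  have Ja a : exists p' q' : R,
      M *m x1 a - V (x2 a) = p' *: x1 false + q' *: x1 true.
    apply: decomp.
    have := X_n1 a; rewrite MX /V !dot_linE.
    have := x1_n1 false a; have := x1_n1 true a.
    rewrite (x2C true) (x2C false).
    by move=> /(congr1 ( *%R q)) t1 /(congr1 ( *%R p)) t0 E; lra.
  have [p0 [q0 e0]] := Ja false; have [p1 [q1 e1]] := Ja true.
  exists (fun a b => if a then if b then q1 else p1 else if b then q0 else p0).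
  by case.
pose c := J false false + J true true.
(* As V x_a is M x_a up to J, the Leibniz rule for the cross product gives
   the trace of M, which is zero, minus M^T n and minus the trace of J. *)
have Vn : V n1 = - (M^T *m n) - c *: n.
  have := trace_cross M (x1 false) (x1 true); rewrite trM scale0r add0r -n_def.
  have Mx a :
      M *m x1 a = V (x2 a) + (J a false *: x1 false + J a true *: x1 true).
    by rewrite -J_def addrC subrK.
  rewrite !Mx => <-; rewrite /V !n1_def n_def /c.
  by apply: cV3P; rewrite !coordE; ring.
(* The second fundamental form is invariant up to the change of parameters J
   and the scaling c of the normal. *)
have Vh a b : p * h1 a b false + q * h1 a b true =
    - c * h a b - (J a false * h false b + J a true * h true b)
    - (J b false * h false a + J b true * h true a).
  have Jn a' b' : dot (M *m x1 a') (n1 b') - dot (V (x2 a')) (n1 b') =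
      - (J a' false * h false b' + J a' true * h true b').
    rewrite -dotNl -dotDl J_def !dot_linE /h.
    have := x1_n1 false b'; have := x1_n1 true b'.
    move=> /eqP; rewrite addrC addr_eq0 => /eqP ->.
    by move=> /eqP; rewrite addrC addr_eq0 => /eqP ->; ring.
  have Vx2 : dot (x2 a b) (V n1) = - dot (M *m x2 a b) n - c * h a b.
    by rewrite Vn !dot_linE -dot_mulmx.
  have := X_n2 a b; rewrite MX !dot_linE.
  have := x1_n2 false a b; have := x1_n2 true a b.
  have := Jn a b; have := Jn b a; move: Vx2.
  rewrite /V !dot_linE /h1 (x3C23 a b false) (x3C23 a b true).
  rewrite (x3C12 a false) (x3C12 a true) (x2C a false) (x2C a true).
  rewrite (x2C b false) (x2C b true) => Vx2 Jba Jab.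
  by move=> /(congr1 ( *%R q)) t1 /(congr1 ( *%R p)) t0 E; lra.
exists p, q, c; split => //.
have e1 : p * D1 false + q * D1 true =
    (p * h1 false false false + q * h1 false false true) * h true true
    + h false false * (p * h1 true true false + q * h1 true true true)
    - 2 * h false true * (p * h1 false true false + q * h1 false true true).
  by rewrite /D1; ring.
have h10 : h true false = h false true by rewrite /h x2C.
by rewrite e1 !Vh h10 /D /c; ring.
Qed.

End InvariantJets.

(** * Vector-valued rational functions *)

Section RegularFields.
Variables (R : realType) (Q : mpoly.mpoly 2 R).
Implicit Types F G : R -> R -> 'cV[R]_3.

Definition vregular F : Prop := forall i, regular Q (fun u v => F u v i 0).

Lemma slice_coord b F u v i :
  (fun s => slice b F u v s i 0) = slice b (fun u v => F u v i 0) u v.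
Proof. by case: b. Qed.

Lemma partial_coord b F u v i : vregular F -> off_zeros Q u v ->
  partial b F u v i 0 = partial b (fun u v => F u v i 0) u v.
Proof.
move=> rF uv; rewrite !partialE !derive1E derive_mx.
  by rewrite mxE slice_coord.
apply/derivable_mxP => j k; rewrite (ord1 k) slice_coord.
by have [] := is_derive_regular b (rF j) uv.
Qed.

Lemma vregular_partial b F : vregular F -> vregular (partial b F).
Proof.
move=> rF i; apply: regular_eq (regular_partial b (rF i)) => u v uv.
by rewrite partial_coord.
Qed.

Lemma regular_dot F G :
  vregular F -> vregular G -> regular Q (fun u v => dot (F u v) (G u v)).
Proof.
move=> rF rG; pose FG i u v := F u v i 0 * G u v i 0.
have rFG i : regular Q (FG i) by exact: regularM.
apply: regular_eq (regularD (regularD (rFG 0) (rFG 1)) (rFG 2%:R)) => u v _.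
by rewrite dotE.
Qed.

Lemma vregular_coords F :
    regular Q (fun u v => F u v 0 0) -> regular Q (fun u v => F u v 1 0) ->
  regular Q (fun u v => F u v 2%:R 0) -> vregular F.
Proof.
move=> r0 r1 r2 [[|[|[|//]]] Hi].
- by rewrite (_ : Ordinal Hi = 0) //; apply: val_inj.
- by rewrite (_ : Ordinal Hi = 1) //; apply: val_inj.
- by rewrite (_ : Ordinal Hi = 2%:R) //; apply: val_inj.
Qed.

Lemma vregular_cross F G :
  vregular F -> vregular G -> vregular (fun u v => cross (F u v) (G u v)).
Proof.
move=> rF rG; pose FG i j u v := F u v i 0 * G u v j 0.
have rFG i j : regular Q (FG i j) by exact: regularM.
apply: vregular_coords.
- apply: regular_eq (regularB (rFG 1 2%:R) (rFG 2%:R 1)) => u v _.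
  by rewrite cross0E.
- apply: regular_eq (regularB (rFG 2%:R 0) (rFG 0 2%:R)) => u v _.
  by rewrite cross1E.
- apply: regular_eq (regularB (rFG 0 1) (rFG 1 0)) => u v _.
  by rewrite cross2E.
Qed.

Lemma vregular_cross_uv F : vregular F -> vregular (cross_uv F).
Proof.
move=> rF.
exact: (vregular_cross (vregular_partial false rF) (vregular_partial true rF)).
Qed.

Lemma vregular_cst (w : 'cV[R]_3) : vregular (fun _ _ => w).
Proof. by move=> i; exact: regular_cst. Qed.

Lemma vregularB F G :
  vregular F -> vregular G -> vregular (fun u v => F u v - G u v).
Proof.
move=> rF rG i; apply: regular_eq (regularB (rF i) (rG i)) => u v _.
by rewrite !mxE.
Qed.

Lemma vregular_mulmx (M : 'M[R]_3) F :
  vregular F -> vregular (fun u v => M *m F u v).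
Proof.
move=> rF i; pose MF j u v := M i j * F u v j 0.
have rMF j : regular Q (MF j) by apply: regularM; [exact: regular_cst|].
apply: regular_eq (regularD (regularD (rMF 0) (rMF 1)) (rMF 2%:R)) => u v _.
by rewrite mulmx_cV3E.
Qed.

Variables (u v : R) (uv : off_zeros Q u v).

Lemma vpartialC b c F : vregular F ->
  partial b (partial c F) u v = partial c (partial b F) u v.
Proof.
move=> rF; apply/colP => i.
rewrite !partial_coord //; try exact: vregular_partial.
have eq_coord d u' v' : off_zeros Q u' v' ->
  partial d F u' v' i 0 = partial d (fun u v => F u v i 0) u' v'.
  exact: partial_coord.
rewrite (partial_eq b (eq_coord c) uv) (partial_eq c (eq_coord b) uv).
exact: partialC uv.
Qed.

Lemma partial_dot b F G : vregular F -> vregular G ->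
  partial b (fun u v => dot (F u v) (G u v)) u v =
    dot (partial b F u v) (G u v) + dot (F u v) (partial b G u v).
Proof.
move=> rF rG; pose FG i u v := F u v i 0 * G u v i 0.
have rFG i : regular Q (FG i) by exact: regularM.
rewrite (@partial_eq _ Q b _ _ (fun u v =>
  FG 0 u v + FG 1 u v + FG 2%:R u v)) //.
  rewrite (partialD b (regularD (rFG 0) (rFG 1)) (rFG 2%:R)) //.
  rewrite (partialD b (rFG 0) (rFG 1)) //.
  rewrite !(partialM b (rF _) (rG _)) // !dotE !partial_coord //; ring.
by move=> u' v' _; rewrite dotE.
Qed.

Lemma partial_cross_coord b F G i j k : vregular F -> vregular G ->
    (forall a c : 'cV[R]_3, cross a c i 0 = a j 0 * c k 0 - a k 0 * c j 0) ->
  partial b (fun u v => cross (F u v) (G u v)) u v i 0 =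
  (cross (partial b F u v) (G u v) + cross (F u v) (partial b G u v)) i 0.
Proof.
move=> rF rG cross_i; pose FG i j u v := F u v i 0 * G u v j 0.
have rFG i' j' : regular Q (FG i' j') by exact: regularM.
rewrite partial_coord //; last exact: vregular_cross.
rewrite (@partial_eq _ Q b _ _ (fun u v => FG j k u v - FG k j u v)) //.
rewrite (partialB b (rFG j k) (rFG k j)) //.
rewrite !(partialM b (rF _) (rG _)) // cV_addE !cross_i !partial_coord //; ring.
Qed.

Lemma partial_cross b F G : vregular F -> vregular G ->
  partial b (fun u v => cross (F u v) (G u v)) u v =
    cross (partial b F u v) (G u v) + cross (F u v) (partial b G u v).
Proof.
move=> rF rG; apply: cV3P.
- by apply: (partial_cross_coord b rF rG) => a c; exact: cross0E.
- by apply: (partial_cross_coord b rF rG) => a c; exact: cross1E.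
- by apply: (partial_cross_coord b rF rG) => a c; exact: cross2E.
Qed.

Lemma partial_mulmx b (M : 'M[R]_3) F : vregular F ->
  partial b (fun u v => M *m F u v) u v = M *m partial b F u v.
Proof.
move=> rF; apply/colP => i.
rewrite partial_coord //; last exact: vregular_mulmx.
pose MF j u v := M i j * F u v j 0.
have rMF j : regular Q (MF j) by apply: regularM; [exact: regular_cst|].
rewrite (@partial_eq _ Q b _ _ (fun u v =>
  MF 0 u v + MF 1 u v + MF 2%:R u v)) //.
  rewrite (partialD b (regularD (rMF 0) (rMF 1)) (rMF 2%:R)) //.
  rewrite (partialD b (rMF 0) (rMF 1)) //.
  by rewrite !(partialZ b _ (rF _)) // mulmx_cV3E !partial_coord.
by move=> u' v' _; rewrite mulmx_cV3E.
Qed.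

Lemma partial_subr_cst b F (w : 'cV[R]_3) : vregular F ->
  partial b (fun u v => F u v - w) u v = partial b F u v.
Proof.
move=> rF; have rw := vregular_cst w; apply/colP => i.
rewrite !partial_coord //; last exact: vregularB rF rw.
rewrite (@partial_eq _ Q b _ _ (fun u v => F u v i 0 - w i 0)) //.
  by rewrite (partialB b (rF i) (rw i)) // partial_cst subr0.
by move=> u' v' _; rewrite !mxE.
Qed.

End RegularFields.

(** * Infinitesimal generators of the rotation groups *)

Section RotationGenerators.
Variable R : realType.

(** The features common to the elliptic, hyperbolic and parabolic groups: the
    velocity [B] at the identity is traceless, as the group preserves volume,
    and vanishes exactly on the axis. *)
Definition axial_generator (G : R -> 'M[R]_3) (B : 'M[R]_3) : Prop :=
  [/\ G 0 = 1%:M,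
      forall i j, is_derive (0 : R) (1 : R) (fun t => G t i j) (B i j),
      \tr B = 0 &
      forall w, B *m w = 0 <-> z_axis w].

Lemma z_axisP (w : 'cV[R]_3) : z_axis w <-> w 0 0 = 0 /\ w 1 0 = 0.
Proof.
split=> [[s ->] | [w0 w1]]; first by rewrite !mxE /= !mulr0 !addr0.
exists (w 2%:R 0); rewrite add0r.
by apply: cV3P; rewrite ?w0 ?w1 !mxE /= ?mulr0 ?mulr1.
Qed.

Lemma matrix3P (A B : 'M[R]_3) :
    [/\ A 0 0 = B 0 0, A 0 1 = B 0 1 & A 0 2%:R = B 0 2%:R] ->
    [/\ A 1 0 = B 1 0, A 1 1 = B 1 1 & A 1 2%:R = B 1 2%:R] ->
    [/\ A 2%:R 0 = B 2%:R 0, A 2%:R 1 = B 2%:R 1 &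
        A 2%:R 2%:R = B 2%:R 2%:R] ->
  A = B.
Proof.
move=> [? ? ?] [? ? ?] [? ? ?]; apply/matrixP => i j.
have eq_ord (k : 'I_3) : [\/ k = 0, k = 1 | k = 2%:R].
  by case: k => [[|[|[|//]]] Hk];
    [constructor 1 | constructor 2 | constructor 3]; apply: val_inj.
by case: (eq_ord i) => ->; case: (eq_ord j) => ->.
Qed.

Lemma is_derive_expRN0 : is_derive (0 : R) (1 : R) (expR \o -%R) (-1 : R).
Proof.
have dN : is_derive (0 : R) (1 : R) (-%R : R -> R) (-1) := is_deriveNid _ _.
have de := is_derive_expR (- 0 : R).
by apply: (is_derive_eq (is_derive1_comp de dN)); rewrite oppr0 expR0 mul1r.
Qed.

Lemma is_derive_cosh0 : is_derive (0 : R) (1 : R) (@cosh R) 0.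
Proof.
have de := is_deriveD (is_derive_expR (0 : R)) is_derive_expRN0.
have dhalf := is_derive_cst (2^-1 : R) (0 : R) (1 : R).
apply: (is_derive_eq (is_deriveM de dhalf)).
by rewrite expR0 /GRing.scale /=; ring.
Qed.

Lemma is_derive_sinh0 : is_derive (0 : R) (1 : R) (@sinh R) 1.
Proof.
have de := is_deriveB (is_derive_expR (0 : R)) is_derive_expRN0.
have dhalf := is_derive_cst (2^-1 : R) (0 : R) (1 : R).
apply: (is_derive_eq (is_deriveM de dhalf)).
by rewrite expR0 /GRing.scale /=; field.
Qed.

Lemma is_derive_half_sqr0 :
  is_derive (0 : R) (1 : R) (fun t : R => t ^+ 2 / 2) 0.
Proof.
have dX := is_deriveX 2 (is_derive_id (0 : R) (1 : R)).
have dhalf := is_derive_cst (2^-1 : R) (0 : R) (1 : R).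
apply: (is_derive_eq (is_deriveM dX dhalf)).
by rewrite /GRing.scale /=; ring.
Qed.

Lemma elliptic_generator : axial_generator (@elliptic_rot R)
  (rows3 [:: [:: 0; -1; 0]; [:: 1; 0; 0]; [:: 0; 0; 0]]).
Proof.
split.
- by apply: matrix3P; split; rewrite !mxE /= ?sin0 ?cos0 ?oppr0.
- have ds := is_derive_sin (0 : R); have dc := is_derive_cos (0 : R).
  rewrite cos0 in ds; rewrite sin0 oppr0 in dc; have dns := is_deriveN ds.
  case=> [[|[|[|//]]] Hi] [[|[|[|//]]] Hj];
    (under [fun t => _]eq_fun do rewrite mxE /=); rewrite mxE /=;
    by [exact: is_derive_cst |].
- by rewrite /mxtrace sum3 !mxE /= !addr0.
move=> w; rewrite z_axisP; split => [Bw | [w0 w1]].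
  have := congr1 (fun a : 'cV[R]_3 => a 0 0) Bw.
  have := congr1 (fun a : 'cV[R]_3 => a 1 0) Bw.
  by rewrite /= !mulmx_cV3E !mxE /=; lra.
by apply: cV3P; rewrite mulmx_cV3E !mxE /= w0 w1; ring.
Qed.

Lemma hyperbolic_generator : axial_generator (@hyperbolic_rot R)
  (rows3 [:: [:: 0; 1; 0]; [:: 1; 0; 0]; [:: 0; 0; 0]]).
Proof.
split.
- by apply: matrix3P; split;
    rewrite !mxE /= /cosh /sinh ?oppr0 ?expR0 ?subrr ?mul0r //; lra.
- have dc := is_derive_cosh0; have ds := is_derive_sinh0.
  case=> [[|[|[|//]]] Hi] [[|[|[|//]]] Hj];
    (under [fun t => _]eq_fun do rewrite mxE /=); rewrite mxE /=;
    by [exact: is_derive_cst |].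
- by rewrite /mxtrace sum3 !mxE /= !addr0.
move=> w; rewrite z_axisP; split => [Bw | [w0 w1]].
  have := congr1 (fun a : 'cV[R]_3 => a 0 0) Bw.
  have := congr1 (fun a : 'cV[R]_3 => a 1 0) Bw.
  by rewrite /= !mulmx_cV3E !mxE /=; lra.
by apply: cV3P; rewrite mulmx_cV3E !mxE /= w0 w1; ring.
Qed.

Lemma parabolic_generator : axial_generator (@parabolic_rot R)
  (rows3 [:: [:: 0; 0; 0]; [:: 1; 0; 0]; [:: 0; 1; 0]]).
Proof.
split.
- by apply: matrix3P; split; rewrite !mxE /= ?expr0n ?mul0r.
- case=> [[|[|[|//]]] Hi] [[|[|[|//]]] Hj];
    (under [fun t => _]eq_fun do rewrite mxE /=); rewrite mxE /=;
    by [exact: is_derive_cst | exact: is_derive_id |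
        exact: is_derive_half_sqr0].
- by rewrite /mxtrace sum3 !mxE /= !addr0.
move=> w; rewrite z_axisP; split => [Bw | [w0 w1]].
  have := congr1 (fun a : 'cV[R]_3 => a 1 0) Bw.
  have := congr1 (fun a : 'cV[R]_3 => a 2%:R 0) Bw.
  by rewrite /= !mulmx_cV3E !mxE /=; lra.
by apply: cV3P; rewrite mulmx_cV3E !mxE /= w0 w1; ring.
Qed.

Lemma rotation_group_generator (S : set 'cV[R]_3) :
    [\/ invariant_under (@elliptic_rot R) S,
        invariant_under (@hyperbolic_rot R) S |
        invariant_under (@parabolic_rot R) S] ->
  exists G B, axial_generator G B /\ invariant_under G S.
Proof.
case=> invS; do 2![eexists]; (split; last exact: invS).
- exact: elliptic_generator.
- exact: hyperbolic_generator.
- exact: parabolic_generator.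
Qed.

End RotationGenerators.

(** * The velocity field of an affine rotation surface *)

Section InvariantVarieties.
Variable R : realType.
Implicit Types (P : mpoly.mpoly 3 R) (S A : set 'cV[R]_3).

Definition grad P (p : 'cV[R]_3) : 'cV[R]_3 := \col_i peval3 (mderiv i P) p.

Definition vanishes_on S P : Prop := forall p, S p -> peval3 P p = 0.

Lemma is_derive_peval3 P (g : R -> 'cV[R]_3) (dg : 'cV[R]_3) (t : R) :
    (forall i, is_derive t (1 : R) (fun s => g s i 0) (dg i 0)) ->
  is_derive t (1 : R) (fun s => peval3 P (g s)) (dot (grad P (g t)) dg).
Proof.
move=> g_dg; apply: (is_derive_eq (is_derive_meval g_dg P)).
by apply: eq_bigr => i _; rewrite mxE.
Qed.

Lemma is_derive_mulmx (G : R -> 'M[R]_3) (B : 'M[R]_3) (a : 'cV[R]_3) t i :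
    (forall i j, is_derive t (1 : R) (fun s => G s i j) (B i j)) ->
  is_derive t (1 : R) (fun s => (G s *m a) i 0) ((B *m a) i 0).
Proof.
move=> dG; have da j := is_deriveM (dG i j) (is_derive_cst (a j 0) t (1 : R)).
rewrite (_ : (fun s => _) = \sum_j ((fun s => G s i j) * cst (a j 0))).
  apply: (is_derive_eq (is_derive_sum da)); rewrite mxE.
  by apply: eq_bigr => j _; rewrite /GRing.scale /= mulr0 add0r mulrC.
by apply/funext => s; rewrite mxE fct_sumE.
Qed.

Lemma regular_peval3 Q (F : R -> R -> 'cV[R]_3) P : vregular Q F ->
  regular Q (fun u v => peval3 P (F u v)).
Proof.
move=> rF.
have regX f k : regular Q f -> regular Q (fun u v => f u v ^+ k).
  move=> rf; elim: k => [|k IHk]; first exact: regular_cst.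
  by apply: regular_eq (regularM rf IHk) => u v _; rewrite exprS.
elim/mpolyind: P => [|c m P _ _ rP].
  by apply: regular_eq (regular_cst Q 0) => u v _; rewrite /peval3 meval0.
have rm := regularM (regularM (regX _ (m 0) (rF 0)) (regX _ (m 1) (rF 1)))
  (regX _ (m 2%:R) (rF 2%:R)).
apply: regular_eq (regularD (regularM (regular_cst Q c) rm) rP) => u v _.
rewrite /peval3 mevalD mevalZ mevalX !big_ord_recr big_ord0 /= mul1r.
by congr (_ * (_ * _ * _) + _); congr (F u v _ 0 ^+ m _); exact: val_inj.
Qed.

Lemma partial_peval3 Q (F : R -> R -> 'cV[R]_3) P b u v :
    vregular Q F -> off_zeros Q u v ->
  partial b (fun u v => peval3 P (F u v)) u v =
    dot (grad P (F u v)) (partial b F u v).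
Proof.
move=> rF uv; rewrite partialE derive1E.
have dF i : is_derive (slot b u v) (1 : R) (fun s => slice b F u v s i 0)
    (partial b F u v i 0).
  rewrite (partial_coord b i rF uv) slice_coord.
  exact: (is_derive_regular b (rF i) uv).
have := is_derive_peval3 P dF; rewrite slice_slot => -[_ <-].
rewrite (_ : (fun s => _) = slice b (fun u v => peval3 P (F u v)) u v) //.
by case: (b).
Qed.

(** The matrix is the conjugate of the generator of the group by the linear
    part of the rigid motion. Its last property holds because a polynomial
    vanishing on [S] vanishes along the orbit of [p], whose velocity at time 0
    is [M *m (p - Q)]. *)
Lemma axial_symmetry_field S A (Q alpha : 'cV[R]_3) :
    affine_rotation_surface S A -> A = line Q alpha ->
  exists M : 'M[R]_3, [/\ \tr M = 0, M *m alpha = 0,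
    forall w, M *m w = 0 -> exists s, w = s *: alpha &
    forall P, vanishes_on S P ->
      forall p, S p -> dot (grad P p) (M *m (p - Q)) = 0].
Proof.
move=> [T [[U [b [UUt _ T_def]]] TA /rotation_group_generator]].
move=> [G [B [[G0 dG trB kerB] invG]]] A_line.
have UtU : U^T *m U = 1%:M := mulmx1C UUt.
have axis_T s : z_axis (T (Q + s *: alpha)).
  by rewrite -TA; exists (Q + s *: alpha); rewrite // A_line; exists s.
have BTQ : B *m (U *m Q + b) = 0.
  by apply/kerB; have := axis_T 0; rewrite scale0r addr0 T_def.
have BT w : B *m T (Q + w) = B *m (U *m w).
  by rewrite T_def (mulmxDr U) addrAC mulmxDr BTQ add0r.
exists (U^T *m B *m U); split.
- by rewrite -mulmxA mxtrace_mulC -mulmxA UUt mulmx1.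
- rewrite -!mulmxA -BT (_ : B *m _ = 0) ?mulmx0 //.
  by apply/kerB; have := axis_T 1; rewrite scale1r.
- move=> w Mw; have /kerB : B *m T (Q + w) = 0.
    rewrite BT -[LHS]mul1mx -UUt -(mulmxA U) (mulmxA U^T) (mulmxA _ U).
    by rewrite Mw mulmx0.
  rewrite -TA => -[a]; rewrite A_line => -[s ->]; rewrite !T_def => /addIr.
  move=> /(congr1 (mulmx U^T)); rewrite !mulmxA UtU !mul1mx => /addrI <-.
  by exists s.
move=> P P0 p Sp.
pose g t := U^T *m (G t *m (U *m p + b) - b).
have Sg t : S (g t).
  have : (T @` S) (G t *m T p).
    by rewrite -[X in X _](invG t); exists (T p) => //; exists p.
  move=> [p' Sp']; rewrite !T_def => e.
  by rewrite /g -e addrK mulmxA UtU mul1mx.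
have g0 : g 0 = p by rewrite /g G0 mul1mx addrK mulmxA UtU mul1mx.
have dg i : is_derive (0 : R) (1 : R) (fun t => g t i 0)
    ((U^T *m B *m U *m (p - Q)) i 0).
  have dUG j k : is_derive (0 : R) (1 : R) (fun t => (U^T *m G t) j k)
      ((U^T *m B) j k).
    have := @is_derive_mulmx (fun t => (G t)^T) B^T (row j U^T)^T 0 k.
    rewrite -trmx_mul mxE -row_mul mxE => dGt.
    rewrite (_ : (fun t => _) = (fun t => ((G t)^T *m (row j U^T)^T) k 0)).
      apply: dGt => i' j'; rewrite mxE; under eq_fun do rewrite mxE.
      exact: dG.
    by apply/funext => t; rewrite -trmx_mul [RHS]mxE -row_mul [RHS]mxE.
  rewrite (_ : (fun t => _) = (fun t => (U^T *m G t *m (U *m p + b)) i 0)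
      + cst (- (U^T *m b) i 0)).
    have := is_deriveD (is_derive_mulmx (U *m p + b) i dUG)
      (is_derive_cst (- (U^T *m b) i 0) (0 : R) (1 : R)).
    move/is_derive_eq; apply; rewrite addr0; congr (_ i 0).
    rewrite -!mulmxA; congr (_ *m _); rewrite -T_def -BT.
    by rewrite [Q + _]addrC subrK.
  by apply/funext => t; rewrite /g mulmxBr mulmxA cV_addE cV_oppE.
have := is_derive_peval3 P dg; rewrite g0 => dPg.
rewrite -[LHS](@derive_val _ _ _ _ _ _ _ dPg) (_ : (fun s => _) = cst 0).
  by rewrite derive_cst.
by apply/funext => t; rewrite P0.
Qed.

End InvariantVarieties.

(** * Tangency of the velocity field *)

Section ParametrizedSurfaces.
Variables (R : realType) (x : rat_param R).

Definition common_denominator : mpoly.mpoly 2 R := \prod_i (frac (x i)).2.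

Lemma common_denominator_neq0 : common_denominator != 0.
Proof. by apply/prodf_neq0 => i _; exact: denom_ratioP. Qed.

Lemma off_zeros_param_dom u v :
  off_zeros common_denominator u v <-> param_dom x u v.
Proof.
rewrite /off_zeros /peval2 rmorph_prod /=.
split=> [/prodf_neq0 nz i | nz]; first exact: (nz i isT).
by apply/prodf_neq0 => i _; exact: nz.
Qed.

Lemma vregular_param_fun : vregular common_denominator (param_fun x).
Proof.
move=> i; exists ((frac (x i)).1 * \prod_(j | j != i) (frac (x j)).2), 0%N.
move=> u v; rewrite expr1 mxE peval2M /off_zeros.
rewrite /common_denominator (bigD1 i) //= peval2M mulf_eq0 negb_or.
by case/andP=> di dj; rewrite -mulf_div divff // mulr1.
Qed.

(** Otherwise the polynomials vanishing on [S] would be stable under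
    differentiation. Indeed the gradient of such a polynomial is orthogonal,
    along the parametrization, to x_u, x_v and the field, hence zero
    generically; its coordinates are again polynomials, and they vanish on [S]
    because the image of the parametrization is dense. *)
Lemma invariant_field_tangent (S : set 'cV[R]_3) (M : 'M[R]_3) (Q : 'cV[R]_3) :
    irreducible_surface S -> parametrizes x S ->
    (exists u v, param_dom x u v) ->
    (forall P, vanishes_on S P ->
       forall p, S p -> dot (grad P p) (M *m (p - Q)) = 0) ->
  forall u v, param_dom x u v ->
    dot (M *m (param_fun x u v - Q)) (cross_uv (param_fun x) u v) = 0.
Proof.
move=> [[F [F_neq0 _ _] S_def] _] [xS x_dense] [u0 [v0 dom0]] MS.
set y := param_fun x; have ry : vregular common_denominator y.
  exact: vregular_param_fun.
have rQ := vregular_cst common_denominator Q.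
have rJ : regular common_denominator
    (fun u v => dot (M *m (y u v - Q)) (cross_uv y u v)).
  by apply: regular_dot (vregular_cross_uv ry); exact/vregular_mulmx/vregularB.
have [J0 | J_neq0] := EM (forall u v, param_dom x u v ->
  dot (M *m (y u v - Q)) (cross_uv y u v) = 0); first exact: J0.
exfalso; move/eqP: F_neq0; apply.
apply: (@mderiv_stable_eq0 _ _ (vanishes_on S)); last 1 first.
- by rewrite S_def => p.
- move=> P i P0; apply: x_dense => u v /off_zeros_param_dom uv.
  have rP := regular_peval3 (mderiv i P) ry.
  have JP0 u' v' : off_zeros common_denominator u' v' ->
      dot (M *m (y u' v' - Q)) (cross_uv y u' v')
      * peval3 (mderiv i P) (y u' v') = 0.
    move=> uv'; have Sy : S (y u' v') by apply: xS; apply/off_zeros_param_dom.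
    have gP b : dot (grad P (y u' v')) (partial b y u' v') = 0.
      rewrite -(partial_peval3 P b ry uv').
      rewrite (@partial_eq _ common_denominator b _ _ (fun _ _ => 0)) //.
        exact: partial_cst.
      by move=> s t /off_zeros_param_dom st; apply/P0/xS.
    have := orthogonal_to_frame i (gP false) (gP true) (MS P P0 _ Sy).
    by rewrite mxE.
  have [J0|] := regular_mul_eq0 common_denominator_neq0 rJ rP JP0; last exact.
  by case: J_neq0 => s t /off_zeros_param_dom; exact: J0.
- by move=> c /(_ _ (xS _ _ dom0)); rewrite /peval3 mevalC.
Qed.

End ParametrizedSurfaces.

(** * The affine conormal and its equivariance *)

(** The formula r f^(r - 1) f', written so as to hold for both signs of f; it
    is obtained from |f|^r = exp (r / 2 * ln (f^2)) to avoid the two cases. *)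
Lemma is_derive_powR_norm (R : realType) (f : R -> R) (t df r : R) :
    is_derive t (1 : R) f df -> f t != 0 ->
  is_derive t (1 : R) (fun s => `|f s| `^ r) (r * (df / f t) * `|f t| `^ r).
Proof.
move=> dft ft0; have f2_gt0 : 0 < (f ^+ 2) t by rewrite exprfctE exprn_even_gt0.
have dln := is_derive1_comp (is_derive1_ln f2_gt0) (is_deriveX 2 dft).
have dexp := is_derive1_comp (is_derive_expR _) (is_deriveZ (r / 2) dln).
have powE s : f s != 0 -> `|f s| `^ r = expR (r / 2 * ln ((f ^+ 2) s)).
  move=> fs; rewrite /powR normr_eq0 (negPf fs); congr expR.
  by rewrite exprfctE -real_normK ?num_real // lnXn ?normr_gt0 //; field.
apply: near_eq_is_derive (is_derive_eq dexp _).
  by move: (derivable_neq0_near dft ft0); apply: filterS => s /powE ->.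
by rewrite powE // /GRing.scale /= exprfctE; field.
Qed.

Section Conormal.
Variable R : realType.

(** The determinant of the second fundamental form with the unit normal
    replaced by the cross product of the partial derivatives, which makes it
    rational. *)
Definition second_form_num (y : R -> R -> 'cV[R]_3) (u v : R) : R :=
  dot (du (du y) u v) (cross_uv y u v) * dot (dv (dv y) u v) (cross_uv y u v)
  - dot (dv (du y) u v) (cross_uv y u v) ^+ 2.

Lemma det_first_formE (y : R -> R -> 'cV[R]_3) u v :
  det_first_form y u v = dot (cross_uv y u v) (cross_uv y u v).
Proof. exact: lagrange_identity. Qed.

Lemma det_second_formE (y : R -> R -> 'cV[R]_3) u v :
  det_second_form y u v =
    second_form_num y u v / dot (cross_uv y u v) (cross_uv y u v).
Proof.
rewrite /det_second_form /unit_normal /second_form_num /enorm.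
move: (du (du y) u v) (dv (dv y) u v) (dv (du y) u v) (cross_uv y u v).
move=> xuu xvv xuv n; rewrite !dotZr.
have <- : (Num.sqrt (dot n n))^-1 ^+ 2 = (dot n n)^-1.
  by rewrite exprVn sqr_sqrtr ?dot_self_ge0.
by ring.
Qed.

Lemma cross_uv_neq0 (y : R -> R -> 'cV[R]_3) u v :
  second_form_num y u v != 0 -> cross_uv y u v != 0.
Proof.
rewrite /second_form_num.
move: (du (du y) u v) (dv (dv y) u v) (dv (du y) u v) (cross_uv y u v).
move=> xuu xvv xuv n; apply: contraNneq => ->; apply/eqP.
by rewrite !dotE !mxE; ring.
Qed.

(** The factor |x_u x x_v|^2 of the first form compensates the two
    normalizations of the normal in the second; both sides are zero at singular
    points. *)
Lemma DeltaE (y : R -> R -> 'cV[R]_3) u v :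
  Delta y u v = second_form_num y u v.
Proof.
rewrite /Delta det_first_formE det_second_formE.
have [-> | /cross_uv_neq0 n_neq0] := eqVneq (second_form_num y u v) 0.
  by rewrite mul0r mulr0.
by rewrite mulrC divfK // dot_self_eq0.
Qed.

(** The curvature is D / |n|^4, so its power -1/4 contributes exactly the factor
    |n| that the unit normal lacks. *)
Lemma conormalE (y : R -> R -> 'cV[R]_3) u v : second_form_num y u v != 0 ->
  conormal y u v = (`|second_form_num y u v| `^ (- 4^-1)) *: cross_uv y u v.
Proof.
move=> D_neq0; have n_neq0 := cross_uv_neq0 D_neq0.
rewrite /conormal /gauss_curvature /unit_normal.
rewrite det_second_formE det_first_formE /enorm scalerA; congr (_ *: _).
set W := dot _ _; have W_gt0 : 0 < W.
  by rewrite lt_neqAle eq_sym dot_self_eq0 n_neq0 dot_self_ge0.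
have s_gt0 : 0 < Num.sqrt W by rewrite sqrtr_gt0.
rewrite -(sqr_sqrtr (ltW W_gt0)); set s := Num.sqrt W in s_gt0 *.
have -> : Num.sqrt (s ^+ 2) = s by rewrite sqrtr_sqr gtr0_norm.
rewrite -mulrA -invfM -exprD normrM powRM //.
rewrite [`|_^-1|]gtr0_norm ?invr_gt0 ?exprn_gt0 //.
rewrite -powR_mulrn ?ltW // -powRN -powRrM.
rewrite (_ : - (2 + 2)%:R * - 4^-1 = 1 :> R); last by field.
by rewrite powRr1 ?ltW // mulfK ?gt_eqF.
Qed.

End Conormal.

Section SupportFunctions.
Variable R : realType.

Lemma partial_orthogonal Q (F G : R -> R -> 'cV[R]_3) :
    vregular Q F -> vregular Q G ->
    (forall u v, off_zeros Q u v -> dot (F u v) (G u v) = 0) ->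
  forall b u v, off_zeros Q u v ->
    dot (partial b F u v) (G u v) + dot (F u v) (partial b G u v) = 0.
Proof.
move=> rF rG FG0 b u v uv; rewrite -(partial_dot uv b rF rG).
by rewrite (partial_eq b FG0 uv) partial_cst.
Qed.

Lemma partial2_orthogonal Q (F G : R -> R -> 'cV[R]_3) :
    vregular Q F -> vregular Q G ->
    (forall u v, off_zeros Q u v -> dot (F u v) (G u v) = 0) ->
  forall b c u v, off_zeros Q u v ->
    dot (partial c (partial b F) u v) (G u v)
    + dot (partial b F u v) (partial c G u v)
    + (dot (partial c F u v) (partial b G u v)
       + dot (F u v) (partial c (partial b G) u v)) = 0.
Proof.
move=> rF rG FG0 b c u v uv.
have rFb := vregular_partial b rF; have rGb := vregular_partial b rG.
rewrite -(partial_dot uv c rFb rG) -(partial_dot uv c rF rGb).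
rewrite -(partialD c (regular_dot rFb rG) (regular_dot rF rGb) uv).
by rewrite (partial_eq c (partial_orthogonal rF rG FG0 b) uv) partial_cst.
Qed.

Lemma regular_second_form_num Q (y : R -> R -> 'cV[R]_3) :
  vregular Q y -> regular Q (second_form_num y).
Proof.
move=> ry; have rp b c := vregular_partial b (vregular_partial c ry).
have rn := vregular_cross_uv ry.
have rh b c := regular_dot (rp b c) rn.
exact: (regularB (regularM (rh false false) (rh true true))
                 (regularM (rh true false) (rh true false))).
Qed.

Lemma partial_conormal Q (y : R -> R -> 'cV[R]_3) b u v :
    vregular Q y -> off_zeros Q u v -> second_form_num y u v != 0 ->
  partial b (conormal y) u v = (`|second_form_num y u v| `^ (- 4^-1)) *:
    (partial b (cross_uv y) u v
     - (partial b (second_form_num y) u v / (4 * second_form_num y u v))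
       *: cross_uv y u v).
Proof.
move=> ry uv D0; have rD := regular_second_form_num ry.
have rn := vregular_cross_uv ry.
have dD := is_derive_regular b rD uv.
have Ds0 : slice b (second_form_num y) u v (slot b u v) != 0.
  by rewrite slice_slot.
pose lam s := `|slice b (second_form_num y) u v s| `^ (- 4^-1).
have dlam : is_derive (slot b u v) (1 : R) lam _ :=
  is_derive_powR_norm (- 4^-1) dD Ds0.
have dn i := is_derive_regular b (rn i) uv.
have dlamn i := is_deriveM dlam (dn i).
pose nu s := lam s *: slice b (cross_uv y) u v s.
have nuE i :
    (fun s => nu s i 0) = lam * slice b (fun u v => cross_uv y u v i 0) u v.
  by apply/funext => s; rewrite /nu cV_scaleE; case: (b).
rewrite partialE derive1E (@near_eq_derive _ _ _ _ nu); last first.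
  move: (derivable_neq0_near dD Ds0); apply: filterS.
  by rewrite /nu /lam; case: (b) => s /= Ds; rewrite conormalE.
rewrite derive_mx; last first.
  by apply/derivable_mxP => i j; rewrite (ord1 j) nuE; have [] := dlamn i.
apply/colP => i; rewrite mxE nuE; have [_ ->] := dlamn i.
rewrite -(partial_coord b i rn uv) /lam !slice_slot !coordE /GRing.scale /=.
by field.
Qed.

Lemma partial_second_form_num Q (y : R -> R -> 'cV[R]_3) c u v :
    vregular Q y -> off_zeros Q u v ->
  let n := cross_uv y u v in let n1 := partial c (cross_uv y) u v in
  let y2 a b := partial b (partial a y) in
  let h a b := dot (y2 a b u v) n in
  let h1 a b := dot (partial c (y2 a b) u v) n + dot (y2 a b u v) n1 in
  partial c (second_form_num y) u v =
    h1 false false * h true true + h false false * h1 true true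
    - 2 * h false true * h1 false true.
Proof.
move=> ry uv n n1 y2 h h1.
have ry2 a b : vregular Q (y2 a b) by exact/vregular_partial/vregular_partial.
have rn := vregular_cross_uv ry.
pose H a b u v := dot (y2 a b u v) (cross_uv y u v).
have rH a b : regular Q (H a b) := regular_dot (ry2 a b) rn.
have H1 a b : partial c (H a b) u v = h1 a b by exact: (partial_dot uv).
exact: (partial_det (rH false false) (rH true true) (rH false true) uv
  (H1 _ _) (H1 _ _) (H1 _ _)).
Qed.

(** The divergence c cancels between the derivative of |D|^(-1/4) and that of
    the normal, leaving the transformation law of covectors. *)
Lemma conormal_equivariant Q (y : R -> R -> 'cV[R]_3) (M : 'M[R]_3) q0 :
    vregular Q y -> \tr M = 0 ->
    (forall u v, off_zeros Q u v ->
       dot (M *m (y u v - q0)) (cross_uv y u v) = 0) ->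
  forall u v, off_zeros Q u v -> second_form_num y u v != 0 ->
  exists p q : R,
    M *m (y u v - q0) = p *: du y u v + q *: dv y u v /\
    p *: du (conormal y) u v + q *: dv (conormal y) u v =
      - (M^T *m conormal y u v).
Proof.
move=> ry trM tangent u v uv D_neq0.
have ry1 a : vregular Q (partial a y) := vregular_partial a ry.
have rn := vregular_cross_uv ry.
have ryq := vregularB ry (vregular_cst Q q0).
have rMy := vregular_mulmx M ryq.
have My1 b u' v' : off_zeros Q u' v' ->
    partial b (fun u v => M *m (y u v - q0)) u' v' = M *m partial b y u' v'.
  move=> uv'.
  by rewrite (partial_mulmx uv' b M ryq) (partial_subr_cst uv' b q0 ry).
have My2 b c : partial c (partial b (fun u v => M *m (y u v - q0))) u v =
    M *m partial c (partial b y) u v.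
  by rewrite (partial_eq c (My1 b) uv) (partial_mulmx uv c M (ry1 b)).
have X1 b := partial_orthogonal rMy rn tangent b uv.
have X2 b c := partial2_orthogonal rMy rn tangent b c uv.
have {}X1 b : dot (M *m partial b y u v) (cross_uv y u v)
    + dot (M *m (y u v - q0)) (partial b (cross_uv y) u v) = 0.
  by rewrite -(My1 b u v uv).
have {}X2 b c : dot (M *m partial c (partial b y) u v) (cross_uv y u v)
    + dot (M *m partial b y u v) (partial c (cross_uv y) u v)
    + (dot (M *m partial c y u v) (partial b (cross_uv y) u v)
       + dot (M *m (y u v - q0)) (partial c (partial b (cross_uv y)) u v)) = 0.
  by rewrite -(My2 b c) -(My1 b u v uv) -(My1 c u v uv).
have yn a u' v' : off_zeros Q u' v' ->
    dot (partial a y u' v') (cross_uv y u' v') = 0.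
  by case: a => _; [exact: dot_cross_r | exact: dot_cross_l].
have [p [q [c [MX Vn VD]]]] := @invariant_jet R M (y u v - q0) (cross_uv y u v)
  (fun a => partial a y u v) (fun a b => partial b (partial a y) u v)
  (fun a b c => partial c (partial b (partial a y)) u v)
  (fun b => partial b (cross_uv y) u v)
  (fun b c => partial c (partial b (cross_uv y)) u v)
  (fun a b => vpartialC uv b a ry)
  (fun a b c => partial_eq c (fun u' v' uv' => vpartialC uv' b a ry) uv)
  (fun a b c => vpartialC uv c b (ry1 a))
  erefl
  (fun b => partial_cross uv b (ry1 false) (ry1 true))
  (cross_uv_neq0 D_neq0)
  (fun a b => partial_orthogonal (ry1 a) rn (yn a) b uv)
  (fun a b c => partial2_orthogonal (ry1 a) rn (yn a) b c uv)
  trM (tangent u v uv) X1 X2.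
exists p, q; split; first exact: MX.
have {}VD : p * partial false (second_form_num y) u v
    + q * partial true (second_form_num y) u v =
    - 4 * c * second_form_num y u v.
  rewrite (partial_second_form_num false ry uv).
  by rewrite (partial_second_form_num true ry uv); exact: VD.
have n1 b := partial_conormal b ry uv D_neq0.
rewrite [du (conormal y) u v](n1 false) [dv (conormal y) u v](n1 true).
rewrite conormalE // -scalemxAr; move: Vn VD.
move: (partial false (cross_uv y) u v) (partial true (cross_uv y) u v).
move: (partial false (second_form_num y) u v).
move: (partial true (second_form_num y) u v).
move: (cross_uv y u v) (second_form_num y u v) D_neq0 (`|_| `^ _).
move=> n D D_neq0 lam D1 D0 n0 n1' Vn VD.
have -> : p *: (lam *: (n0 - (D0 / (4 * D)) *: n))
    + q *: (lam *: (n1' - (D1 / (4 * D)) *: n)) =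
  lam *: ((p *: n0 + q *: n1') - ((p * D0 + q * D1) / (4 * D)) *: n).
  by apply: cV3P; rewrite !coordE; ring.
rewrite Vn VD (_ : - 4 * c * D / (4 * D) = - c); last by field.
by rewrite scaleNr opprK subrK scalerN.
Qed.

End SupportFunctions.

(** * Affine normals and the axis *)

Theorem theorem22 (R : realType) (S : set 'cV[R]_3) (x : rat_param R)
    (A : set 'cV[R]_3) (alpha beta : 'cV[R]_3)
    (S_surface : irreducible_surface S)
    (x_param : parametrizes x S)
    (S_curved : exists u v : R,
       [/\ param_dom x u v, cross_uv (param_fun x) u v != 0 &
           gauss_curvature (param_fun x) u v != 0])
    (S_rotation : affine_rotation_surface S A)
    (A_plucker : plucker_coordinates A beta alpha) :
  forall u v : R, param_dom x u v -> Delta (param_fun x) u v != 0 ->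
    dot alpha (cross (param_fun x u v) (mu (param_fun x) u v))
    + dot beta (mu (param_fun x) u v) = 0.
Proof.
move=> u v uv_dom; rewrite DeltaE => D_neq0.
case: A_plucker => _ [q0 A_line ->].
have [M [trM Malpha kerM MS]] := axial_symmetry_field S_rotation A_line.
have dom_ex : exists u v, param_dom x u v by exists u, v.
have tangent := invariant_field_tangent S_surface x_param dom_ex MS.
have ry := @vregular_param_fun _ x.
have uv := (off_zeros_param_dom x u v).2 uv_dom.
have {}tangent u' v' (uv' : off_zeros (common_denominator x) u' v') :=
  tangent u' v' ((off_zeros_param_dom x u' v').1 uv').
have [p [q [MX Vnu]]] := conormal_equivariant ry trM tangent uv D_neq0.
suff normal_axis : dot (cross alpha (param_fun x u v - q0))
    (cross (du (conormal (param_fun x)) u v)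
           (dv (conormal (param_fun x)) u v)) = 0.
  by rewrite plucker_incidence /mu /Phi !dotZr normal_axis !mulr0.
have [/andP[/eqP p_eq0 /eqP q_eq0] | ] := boolP ((p == 0) && (q == 0)).
  move: MX; rewrite p_eq0 q_eq0 !scale0r addr0 => /kerM[s ->].
  exact: dot_cross_parallel.
rewrite negb_and => pq; apply: (dot_cross_proportional pq); rewrite Vnu.
  by rewrite dotNr -dot_mulmx Malpha dot0l oppr0.
rewrite dotNr -dot_mulmx conormalE // dotZr.
by rewrite (tangent _ _ uv) mulr0 oppr0.
Qed.
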